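(* Let $\mathbb{I}\subset\mathbb{R}$ be a bounded open interval, let $x\in\mathbb{I}$, and let $0\to M\to P_x\to N\to 0$ be an exact sequence of $\Lambda_{\mathbb{I}}$-modules (so that $M$ is regarded as a submodule and $N$ as a quotient module of $P_x$). Then $M$ is decorous if and only if $N$ is decorous.
   Context: Let $\Bbbk$ be an algebraically closed field. $\Lambda_{\mathbb{R}}$ is the $\Bbbk$-linear category with objects the real numbers (plus a zero object) generated by morphisms $\alpha_{yx}:x\to y$ and $\alpha^*_{xy}:y\to x$ for $x<y$, with $\alpha_{xx}=\alpha^*_{xx}=1_x$, subject to: (1) $\alpha_{zy}\alpha_{yx}=\alpha_{zx}$ and $\alpha^*_{xy}\alpha^*_{yz}=\alpha^*_{xz}$ for $x\le y\le z$; (2) $\alpha^*_{x+a-b,x+a}\alpha_{x+a,x}=\alpha_{x+a-b,x-b}\alpha^*_{x-b,x}$ for $a,b>0$. $\Lambda_{\mathbb{I}}$ is the quotient category of $\Lambda_{\mathbb{R}}$ obtained by setting every object $x\notin\mathbb{I}$ isomorphic to zero. A morphism of $\Lambda_{\mathbb{I}}$ is path like if it is a nonzero composition of $\alpha$'s and $\alpha^*$'s; the length of $\alpha_{yx}$ and of $\alpha^*_{xy}$ is $|x-y|$ and the length of a composition is the sum of the lengths. Path like morphisms $x\to y$ are determined by their length and form a basis of $\operatorname{Hom}_{\Lambda_{\mathbb{I}}}(x,y)$. A $\Lambda_{\mathbb{I}}$-module is a $\Bbbk$-linear functor $\Lambda_{\mathbb{I}}\to\Bbbk\text{-}\mathrm{Vec}$,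 and $P_x=\operatorname{Hom}_{\Lambda_{\mathbb{I}}}(x,-)$. For a quotient module $N$ of $P_x$, a path like element of $N(y)$ is the image of a path like $f\in P_x(y)$ provided this image is nonzero; its length is the length of $f$. For a submodule $M\subseteq P_x$ and $y\in\mathbb{I}$ put $\partial_\uparrow(y)=\inf\{\mathrm{length}(f):f\in M(y)\text{ path like}\}$ if $M(y)\neq0$, and $\partial_\uparrow(y)=\sup\{\mathrm{length}(f):f\in\operatorname{Hom}(x,y)\text{ path like}\}$ if $M(y)=0$. $M$ is decorous if for each $y\in\mathbb{I}$ with $M(y)\ne0$ there is a path like $f\in M(y)$ of length $\partial_\uparrow(y)$. For a quotient module $N$ of $P_x$ and $y\in\mathbb{I}$ put $\partial_\downarrow(y)=\sup\{\mathrm{length}(f):f\in N(y)\text{ path like}\}$ if $N(y)\ne0$, and $\partial_\downarrow(y)=\inf\{\mathrm{length}(f):f\in\operatorname{Hom}(x,y)\text{ path like}\}$ if $N(y)=0$. $N$ is decorous if for each $y\in\mathbb{I}$ there is no path like $f\in N(y)$ of length $\partial_\downarrow(y)$. *)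

(* Defs.v *)
From HB Require Import structures.
From mathcomp Require Import all_boot all_order all_algebra.
From mathcomp Require Import boolp classical_sets set_interval reals.
From mathcomp Require Import constructive_ereal ereal.

Set Implicit Arguments.
Unset Strict Implicit.
Unset Printing Implicit Defensive.

Import Order.TTheory GRing.Theory Num.Theory.

Local Open Scope classical_set_scope.
Local Open Scope ring_scope.

Record linCat (k : nzRingType) := LinCat {
  ob :> Type;
  hom : ob -> ob -> lmodType k;
  idm : forall x, hom x x;
  comp : forall x y z, hom y z -> hom x y -> hom x z;
  comp_linear_r : forall x y z (g : hom y z), linear (@comp x y z g);
  comp_linear_l : forall x y z (f : hom x y), linear (fun g => @comp x y z g f);
  compA : forall x y z w (h : hom z w) (g : hom y z) (f : hom x y),
    comp h (comp g f) = comp (comp h g) f;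
  comp1m : forall x y (f : hom x y), comp (idm y) f = f;
  compm1 : forall x y (f : hom x y), comp f (idm x) = f }.

Arguments hom {k} C x y : rename.
Arguments idm {k} C x : rename.
Arguments comp {k C x y z} g f : rename.

(* A C-module is a k-linear functor from C to k-vector spaces (of arbitrary
   dimension); [act f] is the value of the functor at the morphism f. *)
Record lmodule (k : nzRingType) (C : linCat k) := LModule {
  mod_at :> C -> lmodType k;
  act : forall x y : C, hom C x y -> mod_at x -> mod_at y;
  act_linear : forall x y (f : hom C x y), linear (act f);
  act_linear_hom : forall x y (m : mod_at x),
    linear (fun f : hom C x y => act f m);
  act_id : forall x (m : mod_at x), act (idm C x) m = m;
  act_comp : forall x y z (g : hom C y z) (f : hom C x y) (m : mod_at x),
    act (comp g f) m = act g (act f m) }.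

Record lmodmor (k : nzRingType) (C : linCat k) (M N : lmodule C) := LModMor {
  mor_at :> forall x : C, M x -> N x;
  mor_linear : forall x, linear (@mor_at x);
  mor_natural : forall x y (f : hom C x y) (m : M x),
    mor_at (act f m) = act f (mor_at m) }.

Definition representable (k : nzRingType) (C : linCat k) (x : C) : lmodule C :=
  @LModule k C (fun y => hom C x y) (fun y z g f => comp g f)
    (fun y z g => @comp_linear_r k C x y z g)
    (fun y z f => @comp_linear_l k C x y z f)
    (fun y f => comp1m f)
    (fun y z w h g f => esym (compA h g f)).

Definition short_exact (k : nzRingType) (C : linCat k) (M P N : lmodule C)
    (i : lmodmor M P) (p : lmodmor P N) : Prop :=
  forall x : C,
    [/\ injective (i x), range (i x) = [set q | p x q = 0]
      & range (p x) = setT].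

Record preLmod (k : nzRingType) := PreLmod {
  pcar :> Type;
  peq : pcar -> pcar -> Prop;
  pzero : pcar;
  padd : pcar -> pcar -> pcar;
  pscale : k -> pcar -> pcar;
  peq_refl : forall f, peq f f;
  peq_sym : forall f g, peq f g -> peq g f;
  peq_trans : forall f g h, peq f g -> peq g h -> peq f h;
  padd_peq : forall f f' g g',
    peq f f' -> peq g g' -> peq (padd f g) (padd f' g');
  pscale_peq : forall a f f', peq f f' -> peq (pscale a f) (pscale a f');
  paddA : forall f g h, peq (padd f (padd g h)) (padd (padd f g) h);
  paddC : forall f g, peq (padd f g) (padd g f);
  padd0 : forall f, peq (padd pzero f) f;
  pscaleA : forall a b f, peq (pscale a (pscale b f)) (pscale (a * b) f);
  pscale0 : forall f, peq (pscale 0 f) pzero;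
  pscale1 : forall f, peq (pscale 1 f) f;
  pscaleDr : forall a f g,
    peq (pscale a (padd f g)) (padd (pscale a f) (pscale a g));
  pscaleDl : forall a b f,
    peq (pscale (a + b) f) (padd (pscale a f) (pscale b f)) }.

Section QuotientLmod.
Variables (k : nzRingType) (P : preLmod k).

Definition peqb (f g : {classic P}) : bool := `[< peq (f : P) (g : P) >].

Lemma peqb_refl : reflexive peqb.
Proof. by move=> f; apply/asboolP/peq_refl. Qed.

Lemma peqb_sym : symmetric peqb.
Proof. by move=> f g; apply/asboolP/asboolP => /peq_sym. Qed.

Lemma peqb_trans : transitive peqb.
Proof.
by move=> g f h /asboolP fg /asboolP gh; apply/asboolP/(peq_trans fg gh).
Qed.

Canonical peqb_equiv := EquivRel peqb peqb_refl peqb_sym peqb_trans.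

Definition quotLmod := {eq_quot peqb}%qT.
HB.instance Definition _ := Choice.on quotLmod.

Definition qclass (f : P) : quotLmod := \pi_{eq_quot peqb}%qT (f : {classic P}).
Definition qrepr (u : quotLmod) : P := (repr (u : {eq_quot peqb}%qT) : {classic P}).

Lemma qclassP (f g : P) : qclass f = qclass g <-> peq f g.
Proof.
split=> [/eqmodP/asboolP //|fg].
by apply/eqmodP/asboolP.
Qed.

Lemma qreprK (u : quotLmod) : qclass (qrepr u) = u.
Proof. exact: reprK. Qed.

Lemma qclassK (f : P) : peq (qrepr (qclass f)) f.
Proof. by apply/qclassP; rewrite qreprK. Qed.

Definition qzero : quotLmod := qclass (pzero P).
Definition qadd (u v : quotLmod) : quotLmod := qclass (padd (qrepr u) (qrepr v)).
Definition qscale (a : k) (u : quotLmod) : quotLmod := qclass (pscale a (qrepr u)).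
Definition qopp (u : quotLmod) : quotLmod := qscale (-1) u.

Lemma qaddE f g : qadd (qclass f) (qclass g) = qclass (padd f g).
Proof. by apply/qclassP/padd_peq; apply: qclassK. Qed.

Lemma qscaleE a f : qscale a (qclass f) = qclass (pscale a f).
Proof. by apply/qclassP/pscale_peq/qclassK. Qed.

Lemma qaddA : associative qadd.
Proof.
move=> u v w; rewrite -(qreprK u) -(qreprK v) -(qreprK w) !qaddE.
exact/qclassP/paddA.
Qed.

Lemma qaddC : commutative qadd.
Proof.
by move=> u v; rewrite -(qreprK u) -(qreprK v) !qaddE; apply/qclassP/paddC.
Qed.

Lemma qadd0 : left_id qzero qadd.
Proof. by move=> u; rewrite -(qreprK u) qaddE; apply/qclassP/padd0. Qed.

Lemma qscaleDl v : {morph qscale^~ v : a b / a + b >-> qadd a b}.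
Proof.
by move=> a b; rewrite -(qreprK v) !qscaleE qaddE; apply/qclassP/pscaleDl.
Qed.

Lemma qscale1 : left_id 1 qscale.
Proof. by move=> u; rewrite -(qreprK u) qscaleE; apply/qclassP/pscale1. Qed.

Lemma qaddN : left_inverse qzero qopp qadd.
Proof.
move=> u; rewrite -{2}(qscale1 u) /qopp -qscaleDl addNr.
by rewrite -(qreprK u) qscaleE; apply/qclassP/pscale0.
Qed.

HB.instance Definition _ :=
  GRing.isZmodule.Build quotLmod qaddA qaddC qadd0 qaddN.

Lemma qscaleA a b v : qscale a (qscale b v) = qscale (a * b) v.
Proof. by rewrite -(qreprK v) !qscaleE; apply/qclassP/pscaleA. Qed.

Lemma qscaleDr : right_distributive qscale +%R.
Proof.
move=> a u v; rewrite -(qreprK u) -(qreprK v).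
rewrite (qaddE _ _ : _ + _ = _) !qscaleE (qaddE _ _ : _ + _ = _).
exact/qclassP/pscaleDr.
Qed.

HB.instance Definition _ := GRing.Zmodule_isLmodule.Build k quotLmod
  qscaleA qscale1 qscaleDr qscaleDl.

End QuotientLmod.

Record preLinCat (k : nzRingType) := PreLinCat {
  pob : Type;
  phom : pob -> pob -> preLmod k;
  pidm : forall x, phom x x;
  pcomp : forall x y z, phom y z -> phom x y -> phom x z;
  pcomp_peq : forall x y z (g g' : phom y z) (f f' : phom x y),
    peq g g' -> peq f f' -> peq (pcomp g f) (pcomp g' f');
  pcomp_linear_r : forall x y z (g : phom y z) a (f f' : phom x y),
    peq (pcomp g (padd (pscale a f) f'))
        (padd (pscale a (pcomp g f)) (pcomp g f'));
  pcomp_linear_l : forall x y z (f : phom x y) a (g g' : phom y z),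
    peq (pcomp (padd (pscale a g) g') f)
        (padd (pscale a (pcomp g f)) (pcomp g' f));
  pcompA : forall x y z w (h : phom z w) (g : phom y z) (f : phom x y),
    peq (pcomp h (pcomp g f)) (pcomp (pcomp h g) f);
  pcomp1m : forall x y (f : phom x y), peq (pcomp (pidm y) f) f;
  pcompm1 : forall x y (f : phom x y), peq (pcomp f (pidm x)) f }.

Section QuotientLinCat.
Variables (k : nzRingType) (C : preLinCat k).

Definition qhom (x y : pob C) : lmodType k := quotLmod (phom x y).
Definition qidm (x : pob C) : qhom x x := qclass (pidm x).
Definition qcomp x y z (g : qhom y z) (f : qhom x y) : qhom x z :=
  qclass (pcomp (qrepr g) (qrepr f)).

Lemma qcompE x y z (g : phom y z) (f : phom x y) :
  qcomp (qclass g) (qclass f) = qclass (pcomp g f).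
Proof. by apply/qclassP/pcomp_peq; apply: qclassK. Qed.

Lemma qlinE x y a (f g : phom x y) :
  a *: (qclass f : qhom x y) + qclass g = qclass (padd (pscale a f) g).
Proof. by rewrite -qaddE -qscaleE. Qed.

Lemma qcomp_linear_r x y z (g : qhom y z) : linear (@qcomp x y z g).
Proof.
move=> a u v; rewrite -(qreprK g) -(qreprK u) -(qreprK v).
by rewrite qlinE !qcompE qlinE; apply/qclassP/pcomp_linear_r.
Qed.

Lemma qcomp_linear_l x y z (f : qhom x y) :
  linear (fun g => @qcomp x y z g f).
Proof.
move=> a u v; rewrite -(qreprK f) -(qreprK u) -(qreprK v).
by rewrite qlinE !qcompE qlinE; apply/qclassP/pcomp_linear_l.
Qed.

Lemma qcompA x y z w (h : qhom z w) (g : qhom y z) (f : qhom x y) :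
  qcomp h (qcomp g f) = qcomp (qcomp h g) f.
Proof.
rewrite -(qreprK f) -(qreprK g) -(qreprK h) !qcompE.
exact/qclassP/pcompA.
Qed.

Lemma qcomp1m x y (f : qhom x y) : qcomp (qidm y) f = f.
Proof. by rewrite -(qreprK f) qcompE; apply/qclassP/pcomp1m. Qed.

Lemma qcompm1 x y (f : qhom x y) : qcomp f (qidm x) = f.
Proof. by rewrite -(qreprK f) qcompE; apply/qclassP/pcompm1. Qed.

Definition quotLinCat : linCat k :=
  LinCat qcomp_linear_r qcomp_linear_l qcompA qcomp1m qcompm1.

End QuotientLinCat.

Section Presentation.
Variables (k : nzRingType) (T : Type) (gen : T -> T -> Type).

Inductive expr : T -> T -> Type :=
| EGen x y : gen x y -> expr x y
| EId x : expr x x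
| EComp x y z : expr y z -> expr x y -> expr x z
| EZero x y : expr x y
| EAdd x y : expr x y -> expr x y -> expr x y
| EScale x y : k -> expr x y -> expr x y.

Variable rel : forall x y, expr x y -> expr x y -> Prop.

Inductive expr_eq : forall x y, expr x y -> expr x y -> Prop :=
| XRel x y (f g : expr x y) : rel f g -> expr_eq f g
| XRefl x y (f : expr x y) : expr_eq f f
| XSym x y (f g : expr x y) : expr_eq f g -> expr_eq g f
| XTrans x y (f g h : expr x y) : expr_eq f g -> expr_eq g h -> expr_eq f h
| XAdd x y (f f' g g' : expr x y) :
    expr_eq f f' -> expr_eq g g' -> expr_eq (EAdd f g) (EAdd f' g')
| XScale x y a (f f' : expr x y) :
    expr_eq f f' -> expr_eq (EScale a f) (EScale a f')
| XComp x y z (g g' : expr y z) (f f' : expr x y) :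
    expr_eq g g' -> expr_eq f f' -> expr_eq (EComp g f) (EComp g' f')
| XAddA x y (f g h : expr x y) :
    expr_eq (EAdd f (EAdd g h)) (EAdd (EAdd f g) h)
| XAddC x y (f g : expr x y) : expr_eq (EAdd f g) (EAdd g f)
| XAdd0 x y (f : expr x y) : expr_eq (EAdd (EZero x y) f) f
| XScaleA x y a b (f : expr x y) :
    expr_eq (EScale a (EScale b f)) (EScale (a * b) f)
| XScale0 x y (f : expr x y) : expr_eq (EScale 0 f) (EZero x y)
| XScale1 x y (f : expr x y) : expr_eq (EScale 1 f) f
| XScaleDr x y a (f g : expr x y) :
    expr_eq (EScale a (EAdd f g)) (EAdd (EScale a f) (EScale a g))
| XScaleDl x y a b (f : expr x y) :
    expr_eq (EScale (a + b) f) (EAdd (EScale a f) (EScale b f))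
| XCompLinR x y z (g : expr y z) a (f f' : expr x y) :
    expr_eq (EComp g (EAdd (EScale a f) f'))
            (EAdd (EScale a (EComp g f)) (EComp g f'))
| XCompLinL x y z (f : expr x y) a (g g' : expr y z) :
    expr_eq (EComp (EAdd (EScale a g) g') f)
            (EAdd (EScale a (EComp g f)) (EComp g' f))
| XCompA x y z w (h : expr z w) (g : expr y z) (f : expr x y) :
    expr_eq (EComp h (EComp g f)) (EComp (EComp h g) f)
| XComp1m x y (f : expr x y) : expr_eq (EComp (EId y) f) f
| XCompm1 x y (f : expr x y) : expr_eq (EComp f (EId x)) f.

Definition expr_preLmod (x y : T) : preLmod k :=
  @PreLmod k (expr x y) (@expr_eq x y) (EZero x y) (@EAdd x y) (@EScale x y)
    (@XRefl x y) (@XSym x y) (@XTrans x y) (@XAdd x y) (@XScale x y)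
    (@XAddA x y) (@XAddC x y) (@XAdd0 x y) (@XScaleA x y) (@XScale0 x y)
    (@XScale1 x y) (@XScaleDr x y) (@XScaleDl x y).

Definition expr_preLinCat : preLinCat k :=
  @PreLinCat k T expr_preLmod EId EComp
    XComp XCompLinR XCompLinL XCompA XComp1m XCompm1.

Definition presented : linCat k := quotLinCat expr_preLinCat.

Definition pgen x y (a : gen x y) : hom presented x y :=
  qclass (EGen a : phom (p := expr_preLinCat) x y).

End Presentation.

Section Killing.
Variables (k : nzRingType) (C : linCat k) (Z : set C).

(* An object is isomorphic to zero iff its identity vanishes, so the objects in Z
   are made zero by dividing out the ideal generated by their identities. *)
Inductive kill_ideal : forall x y : C, hom C x y -> Prop :=
| KId x : Z x -> kill_ideal (idm C x)
| KZero x y : kill_ideal (0 : hom C x y)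
| KLin x y a (f g : hom C x y) :
    kill_ideal f -> kill_ideal g -> kill_ideal (a *: f + g)
| KCompL x y z (g : hom C y z) (f : hom C x y) :
    kill_ideal f -> kill_ideal (comp g f)
| KCompR x y z (g : hom C y z) (f : hom C x y) :
    kill_ideal g -> kill_ideal (comp g f).

Definition kill_eq x y (f g : hom C x y) : Prop := kill_ideal (f - g).

Lemma kill_eq_refl x y (f : hom C x y) : kill_eq f f.
Proof. by rewrite /kill_eq subrr; apply: KZero. Qed.

Lemma kill_eq_of_eq x y (f g : hom C x y) : f = g -> kill_eq f g.
Proof. by move=> ->; apply: kill_eq_refl. Qed.

Lemma kill_idealD x y (f g : hom C x y) :
  kill_ideal f -> kill_ideal g -> kill_ideal (f + g).
Proof. by move=> If Ig; rewrite -[f]scale1r; apply: KLin. Qed.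

Lemma kill_idealZ x y a (f : hom C x y) : kill_ideal f -> kill_ideal (a *: f).
Proof. by move=> If; rewrite -[_ *: _]addr0; apply: KLin => //; apply: KZero. Qed.

Lemma kill_eq_sym x y (f g : hom C x y) : kill_eq f g -> kill_eq g f.
Proof.
by move=> fg; rewrite /kill_eq -(opprB f g) -scaleN1r; apply: kill_idealZ.
Qed.

Lemma kill_eq_trans x y (f g h : hom C x y) :
  kill_eq f g -> kill_eq g h -> kill_eq f h.
Proof.
by move=> fg gh; rewrite /kill_eq -(subrK g f) -addrA; apply: kill_idealD.
Qed.

Lemma kill_eqD x y (f f' g g' : hom C x y) :
  kill_eq f f' -> kill_eq g g' -> kill_eq (f + g) (f' + g').
Proof.
by move=> ff' gg'; rewrite /kill_eq opprD addrACA; apply: kill_idealD.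
Qed.

Lemma kill_eqZ x y a (f f' : hom C x y) :
  kill_eq f f' -> kill_eq (a *: f) (a *: f').
Proof. by move=> ff'; rewrite /kill_eq -scalerBr; apply: kill_idealZ. Qed.

Lemma kill_eq_comp x y z (g g' : hom C y z) (f f' : hom C x y) :
  kill_eq g g' -> kill_eq f f' -> kill_eq (comp g f) (comp g' f').
Proof.
move=> gg' ff'; apply: (@kill_eq_trans _ _ _ (comp g' f)); rewrite /kill_eq.
- rewrite addrC -scaleN1r -(comp_linear_l f (-1) g' g) scaleN1r addrC.
  exact: KCompR.
- rewrite addrC -scaleN1r -(comp_linear_r g' (-1) f' f) scaleN1r addrC.
  exact: KCompL.
Qed.

Definition kill_preLmod (x y : C) : preLmod k :=
  @PreLmod k (hom C x y) (@kill_eq x y) 0 +%R *:%R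
    (@kill_eq_refl x y) (@kill_eq_sym x y) (@kill_eq_trans x y)
    (@kill_eqD x y) (@kill_eqZ x y)
    (fun f g h => kill_eq_of_eq (addrA f g h))
    (fun f g => kill_eq_of_eq (addrC f g))
    (fun f => kill_eq_of_eq (add0r f))
    (fun a b f => kill_eq_of_eq (scalerA a b f))
    (fun f => kill_eq_of_eq (scale0r f))
    (fun f => kill_eq_of_eq (scale1r f))
    (fun a f g => kill_eq_of_eq (scalerDr a f g))
    (fun a b f => kill_eq_of_eq (scalerDl f a b)).

Definition kill_preLinCat : preLinCat k :=
  @PreLinCat k C kill_preLmod (idm C) (@comp k C) kill_eq_comp
    (fun x y z g a f f' => kill_eq_of_eq (comp_linear_r g a f f'))
    (fun x y z f a g g' => kill_eq_of_eq (comp_linear_l f a g g'))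
    (fun x y z w h g f => kill_eq_of_eq (compA h g f))
    (fun x y f => kill_eq_of_eq (comp1m f))
    (fun x y f => kill_eq_of_eq (compm1 f)).

Definition kill : linCat k := quotLinCat kill_preLinCat.

Definition to_kill (x y : C) (f : hom C x y) :
  hom kill (x : ob kill) (y : ob kill) :=
  qclass (f : phom (p := kill_preLinCat) x y).

End Killing.

Section Lambda.
Variables (R : realType) (k : closedFieldType).

(* The object [Some x] is the real number x, [None] is the zero object. *)
Inductive ladder_gen : option R -> option R -> Type :=
| Alpha (x y : R) : x <= y -> ladder_gen (Some x) (Some y)
| AlphaStar (x y : R) : x <= y -> ladder_gen (Some y) (Some x).

Definition ladder_expr := expr k ladder_gen.
Definition al x y (h : x <= y) : ladder_expr (Some x) (Some y) :=
  EGen k (Alpha h).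
Definition als x y (h : x <= y) : ladder_expr (Some y) (Some x) :=
  EGen k (AlphaStar h).

(* Proofs of [x <= y] are unique, so quantifying over them is harmless. *)
Inductive ladder_rel : forall x y, ladder_expr x y -> ladder_expr x y -> Prop :=
| RZeroOb : ladder_rel (EId k ladder_gen None) (EZero k ladder_gen None None)
| RAlphaId x (h : x <= x) : ladder_rel (al h) (EId k ladder_gen (Some x))
| RAlphaStarId x (h : x <= x) : ladder_rel (als h) (EId k ladder_gen (Some x))
| RAlpha x y z (xy : x <= y) (yz : y <= z) (xz : x <= z) :
    ladder_rel (EComp (al yz) (al xy)) (al xz)
| RAlphaStar x y z (xy : x <= y) (yz : y <= z) (xz : x <= z) :
    ladder_rel (EComp (als xy) (als yz)) (als xz)
| RSquare x a b (h1 : x + a - b <= x + a) (h2 : x <= x + a)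
    (h3 : x - b <= x + a - b) (h4 : x - b <= x) :
    0 < a -> 0 < b ->
    ladder_rel (EComp (als h1) (al h2)) (EComp (al h3) (als h4)).

Definition LambdaR : linCat k := presented ladder_rel.

Variable I : set R.

Definition outside : set LambdaR :=
  [set o : option R | if o is Some x then ~ I x else False].

Definition LambdaI : linCat k := kill outside.

Definition obj (x : R) : LambdaI := Some x.

Definition alpha x y (h : x <= y) : hom LambdaI (obj x) (obj y) :=
  to_kill outside (pgen ladder_rel (Alpha h)).

Definition alphaStar x y (h : x <= y) : hom LambdaI (obj y) (obj x) :=
  to_kill outside (pgen ladder_rel (AlphaStar h)).

(* [composite f l]: f is a composition of alphas and alphaStars whose lengths
   sum up to l. *)
Inductive composite : forall x y, hom LambdaI (obj x) (obj y) -> R -> Prop :=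
| CAlpha x y (h : x <= y) : composite (alpha h) `|x - y|
| CAlphaStar x y (h : x <= y) : composite (alphaStar h) `|x - y|
| CComp x y z (g : hom LambdaI (obj y) (obj z))
    (f : hom LambdaI (obj x) (obj y)) l m :
    composite g l -> composite f m -> composite (comp g f) (l + m).

Definition path_like x y (f : hom LambdaI (obj x) (obj y)) (l : R) : Prop :=
  f != 0 /\ composite f l.

Definition Proj (x : R) : lmodule LambdaI := representable (obj x).

Definition hom_lengths (x y : R) : set R :=
  [set l | exists f : hom LambdaI (obj x) (obj y), path_like f l].

(* A submodule of Proj x is given by a monomorphism i : M -> Proj x, a quotient
   module by an epimorphism p : Proj x -> N. *)
Definition sub_lengths x (M : lmodule LambdaI) (i : lmodmor M (Proj x)) (y : R) :
    set R :=
  [set l | exists2 f : hom LambdaI (obj x) (obj y),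
    range (i (obj y)) f & path_like f l].

Definition path_like_quot x (N : lmodule LambdaI) (p : lmodmor (Proj x) N)
    (y : R) (n : N (obj y)) (l : R) : Prop :=
  n != 0 /\ exists2 f : hom LambdaI (obj x) (obj y),
    path_like f l & p (obj y) f = n.

Definition quot_lengths x (N : lmodule LambdaI) (p : lmodmor (Proj x) N) (y : R) :
    set R :=
  [set l | exists n : N (obj y), path_like_quot p n l].

Definition nonzero_at (M : lmodule LambdaI) (y : R) : Prop :=
  exists m : M (obj y), m != 0.

Definition bound_up x (M : lmodule LambdaI) (i : lmodmor M (Proj x)) (y : R) :
    \bar R :=
  if `[< nonzero_at M y >] then ereal_inf (EFin @` sub_lengths i y)
  else ereal_sup (EFin @` hom_lengths x y).

Definition decorous_sub x (M : lmodule LambdaI) (i : lmodmor M (Proj x)) : Prop :=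
  forall y, I y -> nonzero_at M y ->
    exists2 l, sub_lengths i y l & l%:E = bound_up i y.

Definition bound_down x (N : lmodule LambdaI) (p : lmodmor (Proj x) N) (y : R) :
    \bar R :=
  if `[< nonzero_at N y >] then ereal_sup (EFin @` quot_lengths p y)
  else ereal_inf (EFin @` hom_lengths x y).

Definition decorous_quot x (N : lmodule LambdaI) (p : lmodmor (Proj x) N) : Prop :=
  forall y, I y ->
    ~ exists2 l, quot_lengths p y l & l%:E = bound_down p y.

End Lambda.

(* Main.v *)
Require Import Defs.
From mathcomp Require Import all_boot all_order all_algebra.
From mathcomp Require Import boolp classical_sets set_interval reals.
From mathcomp Require Import constructive_ereal ereal.
From mathcomp Require Import lra.
(* Imported again so that [hom] is a morphism space of a linear category rather
   than the type of linear maps between vector spaces. *)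
Require Import Defs.

Set Implicit Arguments.
Unset Strict Implicit.
Unset Printing Implicit Defensive.

Import Order.TTheory GRing.Theory Num.Theory.

Local Open Scope classical_set_scope.
Local Open Scope ring_scope.

(** The equivalence holds separately at each object y, where it is the fact that
    a cut of a half-open interval has a least upper element exactly when it has
    no greatest lower one.

    By the square relation, a composition of alphas and alphaStars from x to y
    depends only on its length d: it equals the valley [epath x y d] that
    descends from x to w = (x + y - d) / 2 and climbs back to y
    ([composite_epath]). Valleys compose by adding lengths ([epathM]) and span
    the morphisms ([hom_spanned]). A valley vanishes as soon as its bottom w is
    at most l, or the top x + y - w of the equal peak is at least r, since it
    then factors through a zero object ([epath_eq0]). All other valleys are
    nonzero ([epath_neq0]), and this takes a representation of the presented
    category: every generator acts on functions of the length by translation,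
    cut off to the lengths that are still alive. Hence the lengths of path like
    morphisms from x to y fill exactly the interval
    [ |x - y|, lifetime y [ ([path_likeP]).

    Let p : P_x -> N be the quotient map, with kernel M. The lengths of the path
    like morphisms killed by p form an upper set of this interval, because a
    loop at y lengthens a valley by any prescribed amount ([ker_path_up]). The
    lengths of the other ones are those of the path like elements of N(y). What
    remains is that M(y) contains a path like morphism as soon as it is nonzero
    ([ker_has_path]): composing a nonzero combination of valleys with a loop
    that is just long enough to kill all but the shortest of them isolates that
    one. So decorousness of M at y says that the upper part of the cut, if
    nonempty, has a minimum, and decorousness of N at y says that the lower part
    has no maximum. The interval is closed on the left and open on the right, so
    these are equivalent ([upper_min_iff_lower_nomax]). *)

(** * Linear maps and composition *)

Section LinearMaps.
Variables (k : nzRingType) (U V : lmodType k) (f : U -> V).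
Hypothesis f_linear : linear f.

Lemma linear_map0 : f 0 = 0.
Proof. by have := f_linear (-1) 0 0; rewrite !scaleN1r !addNr. Qed.

Lemma linear_mapD u v : f (u + v) = f u + f v.
Proof. by have := f_linear 1 u v; rewrite !scale1r. Qed.

Lemma linear_mapZ t u : f (t *: u) = t *: f u.
Proof. by have := f_linear t u 0; rewrite linear_map0 !addr0. Qed.

End LinearMaps.

Section CompLinear.
Variables (k : nzRingType) (C : linCat k).

Lemma comp0r (a b c : C) (g : hom C b c) : comp g (0 : hom C a b) = 0.
Proof. exact: linear_map0 (comp_linear_r g). Qed.

Lemma compDr (a b c : C) (g : hom C b c) (f f' : hom C a b) :
  comp g (f + f') = comp g f + comp g f'.
Proof. exact: linear_mapD (comp_linear_r g) f f'. Qed.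

Lemma compZr (a b c : C) (g : hom C b c) t (f : hom C a b) :
  comp g (t *: f) = t *: comp g f.
Proof. exact: linear_mapZ (comp_linear_r g) t f. Qed.

Lemma comp0l (a b c : C) (f : hom C a b) : comp (0 : hom C b c) f = 0.
Proof. exact: linear_map0 (comp_linear_l f). Qed.

Lemma compDl (a b c : C) (f : hom C a b) (g g' : hom C b c) :
  comp (g + g') f = comp g f + comp g' f.
Proof. exact: linear_mapD (comp_linear_l f) g g'. Qed.

Lemma compZl (a b c : C) (f : hom C a b) t (g : hom C b c) :
  comp (t *: g) f = t *: comp g f.
Proof. exact: linear_mapZ (comp_linear_l f) t g. Qed.

Lemma comp_sumr (a b c : C) (g : hom C b c) J (s : seq J) (F : J -> hom C a b) :
  comp g (\sum_(j <- s) F j) = \sum_(j <- s) comp g (F j).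
Proof.
by elim: s => [|j s IH]; rewrite ?big_nil ?comp0r // !big_cons compDr IH.
Qed.

Lemma comp_suml (a b c : C) (f : hom C a b) J (s : seq J) (F : J -> hom C b c) :
  comp (\sum_(j <- s) F j) f = \sum_(j <- s) comp (F j) f.
Proof.
by elim: s => [|j s IH]; rewrite ?big_nil ?comp0l // !big_cons compDl IH.
Qed.
End CompLinear.

(** * Normal forms of path like morphisms *)

Section Paths.
Variables (R : realType) (k : closedFieldType) (I : set R).
Implicit Types x y z w d : R.
Local Notation L := (LambdaI k I).
Local Notation al := (@alpha R k I _ _).
Local Notation als := (@alphaStar R k I _ _).

(** Passing to [cls e] crosses both quotients at once: the relations of the
    presentation, then the ideal of the objects outside I. *)
Definition cls (a b : option R) (e : ladder_expr k a b) :
    hom L (a : ob L) (b : ob L) :=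
  to_kill (@outside R k I)
    (qclass (e : phom (p := expr_preLinCat (@ladder_rel R k)) a b)).

Lemma cls_surj a b (f : hom L a b) : exists e, f = @cls a b e.
Proof.
by exists (qrepr (qrepr f)); rewrite /cls /to_kill !qreprK.
Qed.

Lemma cls_eq a b (e e' : ladder_expr k a b) :
  expr_eq (@ladder_rel R k) e e' -> cls e = cls e'.
Proof. by move=> ee'; congr to_kill; apply/qclassP. Qed.

Lemma cls_comp a b c (g : ladder_expr k b c) (f : ladder_expr k a b) :
  cls (EComp g f) = comp (cls g) (cls f).
Proof.
rewrite /cls /to_kill; rewrite [RHS]qcompE; congr qclass.
by rewrite [RHS]qcompE.
Qed.

Lemma cls_add a b (g f : ladder_expr k a b) :
  cls (EAdd g f) = cls g + cls f.
Proof.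
rewrite /cls /to_kill [RHS]qaddE; congr qclass.
by rewrite [RHS]qaddE.
Qed.

Lemma cls_scale a b t (f : ladder_expr k a b) :
  cls (EScale t f) = t *: cls f.
Proof.
rewrite /cls /to_kill [RHS]qscaleE; congr qclass.
by rewrite [RHS]qscaleE.
Qed.

Lemma cls_zero a b : cls (EZero k _ a b) = 0.
Proof. by []. Qed.

Lemma cls_id a : cls (EId k _ a) = idm L a.
Proof. by []. Qed.

Lemma alpha_cls x y (h : x <= y) : al h = cls (Defs.al k h).
Proof. by []. Qed.

Lemma alphaStar_cls x y (h : x <= y) : als h = cls (Defs.als k h).
Proof. by []. Qed.

Lemma alpha_id x (h : x <= x) : al h = idm L (obj k I x).
Proof. by apply: cls_eq; apply/XRel/RAlphaId. Qed.

Lemma alphaStar_id x (h : x <= x) : als h = idm L (obj k I x).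
Proof. by apply: cls_eq; apply/XRel/RAlphaStarId. Qed.

Lemma alphaM x y z (xy : x <= y) (yz : y <= z) (xz : x <= z) :
  comp (al yz) (al xy) = al xz.
Proof. by rewrite !alpha_cls -cls_comp; apply: cls_eq; apply/XRel/RAlpha. Qed.

Lemma alphaStarM x y z (xy : x <= y) (yz : y <= z) (xz : x <= z) :
  comp (als xy) (als yz) = als xz.
Proof. by rewrite !alphaStar_cls -cls_comp; apply/cls_eq/XRel/RAlphaStar. Qed.

(** The defining square x, x + a, x - b, x + a - b with its corners renamed, so
    that it also covers the degenerate cases a = 0 and b = 0. *)
Lemma square p q s t (sq : s <= q) (pq : p <= q) (ts : t <= s) (tp : t <= p) :
  p + s = q + t -> comp (als sq) (al pq) = comp (al ts) (als tp).
Proof.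
move=> e.
have [pltq|qp] := ltrP p q; last first.
  have ? : p = q by lra.
  have ? : t = s by lra.
  by subst; rewrite !alpha_id compm1 comp1m; congr als; apply: bool_irrelevance.
have [sltq|qs] := ltrP s q; last first.
  have ? : s = q by lra.
  have ? : t = p by lra.
  by subst; rewrite !alphaStar_id compm1 comp1m; congr al;
    apply: bool_irrelevance.
have eq : q = p + (q - p) by lra.
have es : s = p + (q - p) - (q - s) by lra.
have et : t = p - (q - s) by lra.
have a0 : 0 < q - p by lra.
have b0 : 0 < q - s by lra.
move: (q - p) (q - s) a0 b0 eq es et => a b a0 b0 ? ? ?; subst.
rewrite !alphaStar_cls !alpha_cls -!cls_comp.
exact/cls_eq/XRel/RSquare.
Qed.

(** Taking the minimum with x and y makes [epath] below a total function of the
    length; it changes nothing when |x - y| <= d. *)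
Definition bottom (x y d : R) : R := Num.min ((x + y - d) / 2) (Num.min x y).

Lemma bottom_lel x y d : bottom x y d <= x.
Proof. by rewrite /bottom !ge_min lexx !orbT. Qed.

Lemma bottom_ler x y d : bottom x y d <= y.
Proof. by rewrite /bottom !ge_min lexx !orbT. Qed.

Definition epath x y d : hom L (obj k I x) (obj k I y) :=
  comp (al (bottom_ler x y d)) (als (bottom_lel x y d)).

Lemma epathE x y d w (wx : w <= x) (wy : w <= y) : d = x + y - 2 * w ->
  epath x y d = comp (al wy) (als wx).
Proof.
move=> ->; have e : bottom x y (x + y - 2 * w) = w.
  rewrite /bottom; have -> : (x + y - (x + y - 2 * w)) / 2 = w by lra.
  by apply/min_idPl; rewrite le_min wx wy.
rewrite /epath; move: (bottom_ler _ _ _) (bottom_lel _ _ _); rewrite e => h1 h2.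
by congr comp; [congr al | congr als]; apply: bool_irrelevance.
Qed.

Lemma epathP x y d : `|x - y| <= d ->
  exists (w : R) (wx : w <= x) (wy : w <= y), d = x + y - 2 * w.
Proof.
rewrite ler_norml => /andP[h1 h2]; exists ((x + y - d) / 2).
have wx : (x + y - d) / 2 <= x by lra.
have wy : (x + y - d) / 2 <= y by lra.
by exists wx, wy; lra.
Qed.

(** Where the two valleys meet at y there is a peak; the square relation turns it
    into a deeper valley, with bottom w + w' - y. *)
Lemma epathM x y z d d' : `|x - y| <= d -> `|y - z| <= d' ->
  comp (epath y z d') (epath x y d) = epath x z (d' + d).
Proof.
move=> /epathP[w [wx [wy dE]]] /epathP[w' [w'y [w'z d'E]]].
rewrite (epathE wx wy dE) (epathE w'y w'z d'E).
have uw : w + w' - y <= w by lra.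
have uw' : w + w' - y <= w' by lra.
rewrite compA -(compA (al w'z)) (square w'y wy uw' uw); last by lra.
have uz : w + w' - y <= z by lra.
have ux : w + w' - y <= x by lra.
rewrite compA (alphaM uw' w'z uz) -compA (alphaStarM uw wx ux).
by rewrite (@epathE _ _ _ _ ux uz) //; lra.
Qed.

Lemma alpha_epath x y (h : x <= y) : al h = epath x y `|x - y|.
Proof.
rewrite (@epathE _ _ _ _ (lexx x) h) ?alphaStar_id ?compm1 //.
by rewrite ler0_norm; lra.
Qed.

Lemma alphaStar_epath x y (h : x <= y) : als h = epath y x `|x - y|.
Proof.
rewrite (@epathE _ _ _ _ h (lexx x)) ?alpha_id ?comp1m //.
by rewrite ler0_norm; lra.
Qed.

Lemma idm_epath x : idm L (obj k I x) = epath x x 0.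
Proof. by rewrite -(alpha_id (lexx x)) alpha_epath subrr normr0. Qed.

Lemma composite_epath x y (f : hom L (obj k I x) (obj k I y)) d :
  composite f d -> `|x - y| <= d /\ f = epath x y d.
Proof.
elim=> {x y f d} [x y h|x y h|x y z g f d' d _ [gd' ->] _ [fd ->]].
- by rewrite alpha_epath.
- by rewrite alphaStar_epath distrC.
split; last exact: epathM.
by apply: (le_trans (ler_distD y x z)); rewrite addrC lerD.
Qed.

Lemma epath_composite x y d : `|x - y| <= d -> composite (epath x y d) d.
Proof.
move=> /epathP[w [wx [wy dE]]]; rewrite (epathE wx wy dE).
have -> : d = `|w - y| + `|w - x| by rewrite !ler0_norm; lra.
by apply: CComp; constructor.
Qed.

(** On morphisms between real numbers, [spanned] is the linear span of the
    valleys. Requiring morphisms from or to the zero object to vanish makes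
    [spanned] stable under composition through it. *)
Definition spanned a b : hom L a b -> Prop :=
  match a, b return hom L a b -> Prop with
  | Some x, Some y => fun f => exists2 s : seq (k * R),
      (forall j, j \in s -> `|x - y| <= j.2) &
      f = \sum_(j <- s) j.1 *: epath x y j.2
  | _, _ => fun f => f = 0
  end.

Lemma spanned_epath x y d :
  `|x - y| <= d -> @spanned (Some x) (Some y) (epath x y d).
Proof.
move=> h; exists [:: (1, d)] => [j|]; first by rewrite inE => /eqP->.
by rewrite big_seq1 scale1r.
Qed.

Lemma spanned0 a b : @spanned a b 0.
Proof. by case: a b => [x|] [y|] //=; exists [::]; rewrite ?big_nil. Qed.

Lemma spannedD a b (f g : hom L a b) :
  spanned f -> spanned g -> spanned (f + g).
Proof.
case: a b f g => [x|] [y|] f g //=; try by move=> -> ->; rewrite addr0.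
move=> [s sP ->] [t tP ->]; exists (s ++ t); last by rewrite big_cat.
by move=> j; rewrite mem_cat => /orP[/sP|/tP].
Qed.

Lemma spannedZ a b c (f : hom L a b) : spanned f -> spanned (c *: f).
Proof.
case: a b f => [x|] [y|] f //=; try by move=> ->; rewrite scaler0.
move=> [s sP ->]; exists [seq (c * j.1, j.2) | j <- s].
  by move=> _ /mapP[j /sP js ->].
by rewrite big_map scaler_sumr; apply: eq_bigr => j _; rewrite scalerA.
Qed.

Lemma spanned_sum a b (J : eqType) (s : seq J) (F : J -> hom L a b) :
  (forall j, j \in s -> spanned (F j)) -> spanned (\sum_(j <- s) F j).
Proof.
move=> h; rewrite big_seq; elim/big_rec: _ => [|j f /h jF]; first exact: spanned0.
exact: spannedD.
Qed.

Lemma spanned_dom_None b (f : hom L None b) : spanned f -> f = 0.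
Proof. by []. Qed.

Lemma spanned_cod_None a (f : hom L a None) : spanned f -> f = 0.
Proof. by case: a f. Qed.

Lemma spanned_comp a b c (g : hom L b c) (f : hom L a b) :
  spanned g -> spanned f -> spanned (comp g f).
Proof.
case: a f => [x|] f; last first.
  by move=> _ /spanned_dom_None ->; rewrite comp0r; apply: spanned0.
case: c g => [z|] g; last first.
  by move=> /spanned_cod_None -> _; rewrite comp0l; apply: spanned0.
case: b g f => [y|] g f; last first.
  by move=> /spanned_dom_None -> _; rewrite comp0l; apply: spanned0.
move=> [t tP ->] [s sP ->].
rewrite comp_suml; apply: spanned_sum => j /tP jP.
rewrite compZl; apply: spannedZ; rewrite comp_sumr.
apply: spanned_sum => i /sP iP; rewrite compZr; apply: spannedZ.
rewrite epathM //; apply: spanned_epath.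
by apply: (le_trans (ler_distD y x z)); rewrite addrC lerD.
Qed.

Lemma idm_None : idm L None = 0.
Proof. by apply: cls_eq; apply/XRel/RZeroOb. Qed.

Lemma hom_spanned a b (f : hom L a b) : spanned f.
Proof.
have [e ->] := cls_surj f; elim: e => {a b f} //.
- move=> a b [x y h|x y h].
    by rewrite -[cls _]/(al h) alpha_epath; apply: spanned_epath.
  by rewrite -[cls _]/(als h) alphaStar_epath; apply: spanned_epath; rewrite distrC.
- case=> [x|]; last by rewrite cls_id idm_None.
  by rewrite cls_id idm_epath; apply: spanned_epath; rewrite subrr normr0.
- by move=> a b c g gS f fS; rewrite cls_comp; apply: spanned_comp.
- by move=> a b; rewrite cls_zero; apply: spanned0.
- by move=> a b f fS g gS; rewrite cls_add; apply: spannedD.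
- by move=> a b c f fS; rewrite cls_scale; apply: spannedZ.
Qed.

(** Collecting equal lengths and dropping zero terms puts a combination of
    valleys in a form whose first term is its shortest one. *)
Lemma hom_expansion x y (f : hom L (obj k I x) (obj k I y)) :
  exists (c : R -> k) (s : seq R),
  [/\ sorted <%R s,
      forall d, d \in s -> `|x - y| <= d /\ c d *: epath x y d != 0
    & f = \sum_(d <- s) c d *: epath x y d].
Proof.
have [t tP fE] := hom_spanned f.
pose c d := \sum_(j <- t | j.2 == d) j.1.
pose u := undup (map snd t).
exists c, (sort <=%R [seq d <- u | c d *: epath x y d != 0]); split.
- by rewrite sort_lt_sorted filter_uniq // undup_uniq.
- move=> d; rewrite mem_sort mem_filter mem_undup => /andP[cd /mapP[j /tP jt dE]].
  by rewrite dE in cd *.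
rewrite (perm_big _ (permEl (perm_sort _ _))) big_filter.
rewrite big_rmcond => [|d]; last by rewrite negbK => /eqP.
under eq_bigr do rewrite /c scaler_suml.
rewrite (exchange_big_dep predT) //= fE big_seq [RHS]big_seq.
apply: eq_bigr => j jt;
rewrite (eq_bigl (fun d => d == j.2)) => [|d]; last exact: eq_sym.
rewrite -big_filter filter_pred1_uniq ?undup_uniq ?mem_undup ?map_f //.
by rewrite big_seq1.
Qed.

End Paths.

(** * A representation by truncated translations *)

Section Model.
Variables (R : realType) (k : closedFieldType) (l r x : R).
Implicit Types y z w d : R.
Implicit Types a b c : option R.
Local Notation I := `]l, r[%classic.
Local Notation L := (LambdaI k I).
Local Notation expr_rel := (expr_eq (@ladder_rel R k)).

(** [live (Some y) d] says that the valley of length d from x to y is meant to be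
    nonzero: |x - y| <= d, its bottom lies above l and the top of the equal peak
    below r. *)
Definition live a d : bool :=
  if a is Some y then
    [&& x - y <= d, y - x <= d, d < x + y - 2 * l & d < 2 * r - x - y]
  else false.

(** Composition with a morphism of length d moves the coefficient of the valley
    of length s - d to the valley of length s, if both are alive. *)
Definition transport a b d (phi : R -> k) : R -> k :=
  fun s => if live b s && live a (s - d) then phi (s - d) else 0.

(** The action of the presented category on P_x, a combination of valleys being
    encoded by its function of coefficients. Arbitrary functions on R are allowed,
    so the identity of a acts as the projection onto the functions supported on
    live lengths. *)
Fixpoint interp a b (e : ladder_expr k a b) : (R -> k) -> R -> k :=
  match e with
  | EGen _ _ (Alpha y z _) => transport (Some y) (Some z) (z - y)
  | EGen _ _ (AlphaStar y z _) => transport (Some z) (Some y) (z - y)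
  | EId a => transport a a 0
  | EComp _ _ _ g f => fun phi => interp g (interp f phi)
  | EZero _ _ => fun _ _ => 0
  | EAdd _ _ f g => fun phi s => interp f phi s + interp g phi s
  | EScale _ _ t f => fun phi s => t * interp f phi s
  end.

(** Translations compose when being alive at both ends forces being alive in the
    middle, which holds along all the paths in the defining relations. *)
Lemma transportM a b c d d' phi :
  (forall s, live c s -> live a (s - (d + d')) -> live b (s - d)) ->
  transport b c d (transport a b d' phi) = transport a c (d + d') phi.
Proof.
move=> h; apply/funext => s; rewrite /transport -addrA -opprD.
have := h s; case: (live c s) (live a _) (live b _) => [] [] [] //= H.
by have := H isT isT.
Qed.

Lemma interp_linear a b (e : ladder_expr k a b) t phi psi :
  interp e (fun s => t * phi s + psi s) =
  fun s => t * interp e phi s + interp e psi s.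
Proof.
have trans a' b' d phi' psi' :
    transport a' b' d (fun s => t * phi' s + psi' s) =
    fun s => t * transport a' b' d phi' s + transport a' b' d psi' s.
  by apply/funext => s; rewrite /transport; case: ifP; rewrite // mulr0 addr0.
elim: e phi psi => {a b} [_ _ [y z h|y z h]|a|a b c g IHg f IHf|a b|
  a b f IHf g IHg|a b u f IHf] phi psi //=.
- by rewrite IHf IHg.
- by apply/funext => s; rewrite mulr0 addr0.
- by apply/funext => s; rewrite IHf IHg mulrDr addrACA.
- by apply/funext => s; rewrite IHf mulrDr !mulrA (mulrC u).
Qed.

Lemma interp0 a b (e : ladder_expr k a b) : interp e (fun=> 0) = fun=> 0.
Proof.
have := interp_linear e (-1) (fun=> 0) (fun=> 0).
under [X in interp e X]eq_fun do rewrite mulr0 addr0.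
by move=> ->; apply/funext => s; rewrite mulN1r addNr.
Qed.

Lemma interp_idl a b (e : ladder_expr k a b) phi :
  transport b b 0 (interp e phi) = interp e phi.
Proof.
have trans a' b' d phi' :
  transport b' b' 0 (transport a' b' d phi') = transport a' b' d phi'.
  by rewrite transportM ?add0r // => s; rewrite subr0.
elim: e phi => {a b} [_ _ [y z h|y z h]|a|a b c g IHg f IHf|a b|
  a b f IHf g IHg|a b u f IHf] phi //=.
- by apply/funext => s; rewrite /transport if_same.
- apply/funext => s; rewrite -[in RHS]IHf -[in RHS]IHg /transport subr0.
  by case: ifP => //; rewrite addr0.
- apply/funext => s; rewrite -[in RHS]IHf /transport subr0.
  by case: ifP => //; rewrite mulr0.
Qed.

Lemma interp_idr a b (e : ladder_expr k a b) phi :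
  interp e (transport a a 0 phi) = interp e phi.
Proof.
have trans a' b' d phi' :
  transport a' b' d (transport a' a' 0 phi') = transport a' b' d phi'.
  by rewrite transportM ?addr0.
elim: e phi => {a b} [_ _ [y z h|y z h]|a|a b c g IHg f IHf|a b|
  a b f IHf g IHg|a b u f IHf] phi //=.
- by rewrite IHf.
- by rewrite IHf IHg.
- by rewrite IHf.
Qed.

Lemma interp_rel a b (e e' : ladder_expr k a b) :
  ladder_rel e e' -> interp e = interp e'.
Proof.
case=> {a b e e'} /=.
- by apply/funext => phi; apply/funext => s.
- by move=> y _; rewrite subrr.
- by move=> y _; rewrite subrr.
- move=> y z w yz zw _; apply/funext => phi; rewrite transportM.
    by congr transport; lra.
  by rewrite /live => s; lra.
- move=> y z w yz zw _; apply/funext => phi; rewrite transportM.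
    by congr transport; lra.
  by rewrite /live => s; lra.
- move=> y a b _ _ _ _ a0 b0; apply/funext => phi; rewrite !transportM.
  + by congr transport; lra.
  + by rewrite /live => s; lra.
  + by rewrite /live => s; lra.
Qed.

Lemma interp_expr_eq a b (e e' : ladder_expr k a b) :
  expr_rel e e' -> interp e = interp e'.
Proof.
elim=> {a b e e'} //=.
- exact: interp_rel.
- by move=> a b f g h _ -> _ ->.
- by move=> a b f f' g g' _ -> _ ->.
- by move=> a b t f f' _ ->.
- by move=> a b c g g' f f' _ -> _ ->.
- by move=> a b f g h; do 2!apply/funext => ?; rewrite addrA.
- by move=> a b f g; do 2!apply/funext => ?; rewrite addrC.
- by move=> a b f; do 2!apply/funext => ?; rewrite add0r.
- by move=> a b t u f; do 2!apply/funext => ?; rewrite mulrA.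
- by move=> a b f; do 2!apply/funext => ?; rewrite mul0r.
- by move=> a b f; do 2!apply/funext => ?; rewrite mul1r.
- by move=> a b t f g; do 2!apply/funext => ?; rewrite mulrDr.
- by move=> a b t u f; do 2!apply/funext => ?; rewrite mulrDl.
- by move=> a b c g t f f'; apply/funext => phi; rewrite interp_linear.
- by move=> a b f; apply/funext => phi; rewrite interp_idl.
- by move=> a b f; apply/funext => phi; rewrite interp_idr.
Qed.

Definition interpR a b (f : hom (LambdaR R k) a b) := interp (qrepr f).

Lemma interpRE a b (e : ladder_expr k a b) :
  interpR (qclass (e : phom (p := expr_preLinCat (@ladder_rel R k)) a b)) =
  interp e.
Proof.
apply: interp_expr_eq.
exact: (qclassK (e : phom (p := expr_preLinCat (@ladder_rel R k)) a b)).
Qed.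

Lemma live_outside a : @outside R k I a -> forall s, live a s = false.
Proof.
case: a => [y|] //= nIy s; apply/negbTE/negP => h; apply: nIy => /=.
by rewrite in_itv /=; move: h; lra.
Qed.

Lemma interpR_comp a b c (g : hom (LambdaR R k) b c)
    (f : hom (LambdaR R k) a b) :
  interpR (comp g f) = interpR g \o interpR f.
Proof. by rewrite -[comp g f]/(qcomp _ _) interpRE. Qed.

Lemma interpR_kill a b (f : hom (LambdaR R k) a b) :
  kill_ideal (@outside R k I) f -> interpR f = fun _ _ => 0.
Proof.
elim=> {a b f}.
- move=> a oa; rewrite interpRE /=; do 2!apply/funext => ?.
  by rewrite /transport live_outside.
- by move=> a b; rewrite interpRE.
- move=> a b t f g _ f0 _ g0.
  rewrite -(qreprK f) -(qreprK g) qlinE interpRE /=.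
  move: f0 g0; rewrite /interpR => -> ->.
  by do 2!apply/funext => ?; rewrite mulr0 addr0.
- move=> a b c g f _ f0; rewrite interpR_comp f0.
  by apply/funext => phi; apply: interp0.
- by move=> a b c g f _ g0; rewrite interpR_comp g0.
Qed.

(** The valley of length d sends the coefficient function of the identity of x to
    a function that takes the value 1 at d. *)
Lemma epath_neq0 y d :
  `|x - y| <= d -> d < x + y - 2 * l -> d < 2 * r - x - y ->
  epath k I x y d != 0.
Proof.
move=> dxy dl dr; have [w [wx [wy dE]]] := epathP dxy.
rewrite (epathE k I wx wy dE); apply/eqP.
rewrite alpha_cls alphaStar_cls -cls_comp -cls_zero => /qclassP.
rewrite -[peq _ _]/(kill_ideal _ (_ - _)) => /interpR_kill.
rewrite [X in interpR X]subr0 interpRE.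
move=> /(congr1 (fun F => F (fun s => (s == 0)%:R) d)) /=.
move: dxy; rewrite ler_norml => /andP[dxy1 dxy2].
rewrite /transport ifT; last by rewrite /live; lra.
rewrite ifT; last by rewrite /live; lra.
rewrite (_ : d - _ - _ = 0); last by lra.
by rewrite eqxx => /eqP; rewrite oner_eq0.
Qed.
End Model.

(** * Vanishing of long paths *)

Section Vanish.
Variables (R : realType) (k : closedFieldType) (I : set R).
Lemma idm_outside (y : R) : ~ I y -> idm (LambdaI k I) (obj k I y) = 0.
Proof.
move=> nI; apply/qclassP; rewrite -[peq _ _]/(kill_ideal _ (_ - _)).
by rewrite subr0; apply: KId.
Qed.

Lemma comp_outside (a b : LambdaI k I) (y : R)
  (g : hom (LambdaI k I) (obj k I y) b)
  (f : hom (LambdaI k I) a (obj k I y)) : ~ I y -> comp g f = 0.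
Proof. by move=> /idm_outside y0; rewrite -(comp1m f) y0 comp0l comp0r. Qed.

End Vanish.

Lemma epath_eq0 (R : realType) (k : closedFieldType) (l r x y d : R) :
  `|x - y| <= d ->
  (x + y - 2 * l <= d) || (2 * r - x - y <= d) ->
  epath k `]l, r[%classic x y d = 0.
Proof.
move=> dxy /orP[dl|dr].
- have [w [wx [wy dE]]] := epathP dxy; rewrite (epathE k _ wx wy dE).
  apply: comp_outside => /=.
  by rewrite in_itv /=; lra.
  (* A valley of length d equals the peak of length d, with top t. *)
- set t := (x + y + d) / 2.
  move: (dxy); rewrite ler_norml => /andP[d1 d2].
  have xt : x <= t by rewrite /t; lra.
  have yt : y <= t by rewrite /t; lra.
  have -> : d = `|t - y| + `|x - t|.
    by rewrite ger0_norm ?ler0_norm /t; lra.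
  rewrite -(@epathM _ _ _ _ t) //; apply: comp_outside.
  by rewrite /= in_itv /= /t; lra.
Qed.

(** * Cuts of a half-open interval *)

Lemma eq_ereal_inf_min (R : realType) (A : set R) a : A a ->
  a%:E = ereal_inf (EFin @` A) <-> lbound A a.
Proof.
move=> Aa; split=> [aE b Ab|lba].
  by rewrite -lee_fin aE; apply: ereal_inf_lbound; exists b.
apply/eqP; rewrite eq_le; apply/andP; split; last first.
  by apply: ereal_inf_lbound; exists a.
by apply: le_ereal_inf_tmp => _ [b Ab <-]; rewrite lee_fin lba.
Qed.

Lemma eq_ereal_sup_max (R : realType) (A : set R) a : A a ->
  a%:E = ereal_sup (EFin @` A) <-> ubound A a.
Proof.
move=> Aa; split=> [aE b Ab|uba].
  by rewrite -lee_fin aE; apply: ereal_sup_ubound; exists b.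
apply/eqP; rewrite eq_le; apply/andP; split.
  by apply: ereal_sup_ubound; exists a.
by apply: ge_ereal_sup => _ [b Ab <-]; rewrite lee_fin uba.
Qed.

(** The infimum of a nonempty U lies in the interval, which is closed on the left;
    it belongs to one of the two parts, either as the minimum of U or as the
    maximum of Q. Not both exist, since a midpoint would lie in neither part; an
    empty U excludes a maximum of Q, as the interval has no maximum. *)
Lemma upper_min_iff_lower_nomax (R : realType) (a b : R) (U Q : set R) :
  U `|` Q = `[a, b[%classic -> (forall q u, Q q -> U u -> q < u) ->
  (U !=set0 -> exists2 u, U u & lbound U u) <->
  ~ exists2 q, Q q & ubound Q q.
Proof.
move=> UQ QU.
have UQP d : (U d \/ Q d) <-> a <= d < b.
  by rewrite -[_ \/ _]/((U `|` Q) d) UQ /= in_itv.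
split=> [Umin [q Qq qmax]|Qnomax [u Uu]].
- have /andP[aq qb] : a <= q < b by apply/UQP; right.
  (* The right end b stands in for the minimum of U when U is empty. *)
  have [e qe [eb eU]] : exists2 e, q < e & e <= b /\ lbound U e.
    have [/Umin[u Uu ulb]|U0] := pselect (U !=set0).
      exists u; first exact: QU.
      by split=> //; apply: ltW; have /andP[] : a <= u < b by apply/UQP; left.
    by exists b => //; split=> // u Uu; case: U0; exists u.
  have [Um|Qm] : U ((q + e) / 2) \/ Q ((q + e) / 2) by apply/UQP; lra.
  + by have := eU _ Um; lra.
  + by have := qmax _ Qm; lra.
- have Uinf : has_inf U.
    split; first by exists u.
    by exists a => v Uv; have /andP[] : a <= v < b by apply/UQP; left.
  have infP : lbound U (inf U) by exact: inf_lbound Uinf.2.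
  have : U (inf U) \/ Q (inf U).
    apply/UQP; apply/andP; split.
      apply: lb_le_inf; first by exists u.
      by move=> v Uv; have /andP[] : a <= v < b by apply/UQP; left.
    apply: le_lt_trans (infP _ Uu) _.
    by have /andP[] : a <= u < b by apply/UQP; left.
  case=> [Ui|Qi]; first by exists (inf U).
  case: Qnomax; exists (inf U) => // q Qq.
  by apply: lb_le_inf; [exists u | move=> v Uv; apply/ltW/QU].
Qed.

(** * Kernels of quotient maps of the projective at x *)

Section Kernel.
Variables (R : realType) (k : closedFieldType) (l r x : R).
Local Notation I := `]l, r[%classic.
Variables (N : lmodule (LambdaI k I)) (p : lmodmor (Proj k I x) N).
Local Notation path := (epath k I x).

(** The length at which the bottom of a valley from x to y reaches l or the top of
    the equal peak reaches r. *)
Definition lifetime (y : R) : R := Num.min (x + y - 2 * l) (2 * r - x - y).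

Lemma epath_eq0E y d : `|x - y| <= d -> (path y d == 0) = (lifetime y <= d).
Proof.
move=> dxy; rewrite /lifetime ge_min.
apply/idP/idP => [|h]; last by apply/eqP/epath_eq0.
apply: contraLR; rewrite negb_or -!ltNge => /andP[d1 d2].
exact: epath_neq0.
Qed.

Lemma path_likeP y (f : hom (LambdaI k I) (obj k I x) (obj k I y)) d :
  path_like f d <-> [/\ `|x - y| <= d, d < lifetime y & f = path y d].
Proof.
split=> [[f0 /composite_epath[dxy fE]]|[dxy dD ->]].
  by split=> //; rewrite ltNge -epath_eq0E // -fE.
by split; [rewrite epath_eq0E // -ltNge | exact: epath_composite].
Qed.

Lemma ker_comp y z (g : hom (LambdaI k I) (obj k I y) (obj k I z)) f :
  p (obj k I y) f = 0 -> p (obj k I z) (comp g f) = 0.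
Proof.
move=> f0; rewrite -[comp g f]/(act (l := Proj k I x) g f) mor_natural f0.
exact: linear_map0 (act_linear (l := N) g).
Qed.

Lemma ker_path_up y d d' : `|x - y| <= d -> d <= d' ->
  p (obj k I y) (path y d) = 0 -> p (obj k I y) (path y d') = 0.
Proof.
move=> dxy dd' d0; rewrite (_ : d' = (d' - d) + d); last by rewrite subrK.
by rewrite -(@epathM _ _ _ x y y) ?subrr ?normr0 ?subr_ge0 //; apply: ker_comp.
Qed.

(** Let m be the shortest length in the expansion of f and n the next one. A loop
    of length e = lifetime y - n kills every term but the first, and e + m < e + n
    = lifetime y, so the first term survives. *)
Lemma ker_has_path y f : p (obj k I y) f = 0 -> f != 0 ->
  exists d, [/\ `|x - y| <= d, d < lifetime y & p (obj k I y) (path y d) = 0].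
Proof.
move=> pf f0; have [c [s [s_sorted sP fE]]] := hom_expansion f.
case: s => [|m s] in s_sorted sP fE; first by rewrite fE big_nil eqxx in f0.
have ltD d : d \in m :: s -> d < lifetime y.
  move=> /sP[dxy]; rewrite scaler_eq0 negb_or => /andP[_].
  by rewrite epath_eq0E // -ltNge.
(* If s is empty there is nothing to kill, and the default makes e = 0. *)
pose e := lifetime y - head (lifetime y) s.
have e0 : 0 <= e.
  rewrite subr_ge0; case: (s) ltD => //= n s' ltD.
  by rewrite ltW // ltD // !inE eqxx orbT.
have [mxy cm] := sP _ (mem_head m s).
have mD : e + m < lifetime y.
  rewrite /e; case: (s) s_sorted (ltD m) => /= [_|n s' /andP[mn _] _]; last by lra.
  by move=> /(_ (mem_head _ _)); lra.
have compE d : `|x - y| <= d -> comp (epath k I y y e) (path y d)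
    = path y (e + d).
  by move=> dxy; rewrite epathM ?subrr ?normr0.
exists (e + m); split=> //; first by lra.
have : p (obj k I y) (comp (epath k I y y e) f) = 0 by exact: ker_comp.
rewrite fE comp_sumr big_cons big_seq big1 => [|d ds].
  rewrite addr0 compZr compE // (linear_mapZ (@mor_linear _ _ _ _ p _)) => /eqP.
  by rewrite scaler_eq0 => /orP[]/eqP // c0; rewrite c0 scale0r eqxx in cm.
have [dxy _] := sP d (mem_behead (s := m :: s) ds).
rewrite compZr compE //; apply/eqP; rewrite scaler_eq0 epath_eq0E; last by lra.
apply/orP; right; rewrite /e.
case: (s) s_sorted ds => //= n s' /andP[_ ns']; rewrite inE => /predU1P[->|ds].
  by lra.
have := order_path_min lt_trans ns' => /allP/(_ d ds); lra.
Qed.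

Definition ker_lengths y := [set d | [/\ `|x - y| <= d, d < lifetime y
  & p (obj k I y) (path y d) = 0]].

Lemma quot_lengthsP y d : quot_lengths p y d <->
  [/\ `|x - y| <= d, d < lifetime y & p (obj k I y) (path y d) <> 0].
Proof.
split=> [[n [n0 [f /path_likeP[dxy dD ->] pf]]]|[dxy dD pd]].
  by split=> //; rewrite pf; apply/eqP.
exists (p (obj k I y) (path y d)); split; first exact/eqP.
by exists (path y d) => //; apply/path_likeP.
Qed.

Variables (M : lmodule (LambdaI k I)) (i : lmodmor M (Proj k I x)).
Hypothesis ip : short_exact i p.

Lemma range_ker y f : range (i (obj k I y)) f <-> p (obj k I y) f = 0.
Proof. by have [_ -> _] := ip (obj k I y). Qed.

Lemma sub_lengthsE y : sub_lengths i y = ker_lengths y.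
Proof.
apply/seteqP;
  split=> [d [f /range_ker pf /path_likeP[dxy dD fE]]|d [dxy dD pd]].
  by split=> //; rewrite -fE.
by exists (path y d); [apply/range_ker | apply/path_likeP].
Qed.

Lemma nonzero_atP y : nonzero_at M y <-> ker_lengths y !=set0.
Proof.
split=> [[m m0]|[d [dxy dD /range_ker[m _ mE]]]].
  apply: (@ker_has_path y (i (obj k I y) m)).
     by apply/range_ker; exists m.
  apply: contra_neq m0 => im0; have [inj _ _] := ip (obj k I y).
  by apply: inj; rewrite im0 (linear_map0 (@mor_linear _ _ _ _ i _)).
exists m; apply/eqP => m0.
have : path y d != 0 by rewrite epath_eq0E // -ltNge.
by rewrite -mE m0 (linear_map0 (@mor_linear _ _ _ _ i _)) eqxx.
Qed.

Lemma decorous_at y :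
  (nonzero_at M y -> exists2 d, sub_lengths i y d & d%:E = bound_up i y) <->
  ~ exists2 d, quot_lengths p y d & d%:E = bound_down p y.
Proof.
have -> : (nonzero_at M y -> exists2 d, sub_lengths i y d & d%:E = bound_up i y)
  <-> (ker_lengths y !=set0 ->
       exists2 d, ker_lengths y d & lbound (ker_lengths y) d).
  split=> h => [/nonzero_atP|] My.
    have [d] := h My.
    rewrite /bound_up asboolT // sub_lengthsE => dK /(eq_ereal_inf_min dK).
    by exists d.
  have [d dK dmin] := h (iffLR (nonzero_atP y) My).
  rewrite /bound_up asboolT // sub_lengthsE; exists d => //.
  exact/eq_ereal_inf_min.
have -> : (exists2 d, quot_lengths p y d & d%:E = bound_down p y) <->
  exists2 d, quot_lengths p y d & ubound (quot_lengths p y) d.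
  have dE d : quot_lengths p y d ->
      bound_down p y = ereal_sup (EFin @` quot_lengths p y).
    by move=> [n [n0 _]]; rewrite /bound_down asboolT //; exists n.
  split=> -[d Qd]; exists d => //.
    by apply/(eq_ereal_sup_max Qd); rewrite -(dE d).
  by rewrite (dE d) //; apply/eq_ereal_sup_max.
apply: (@upper_min_iff_lower_nomax _ `|x - y| (lifetime y)).
  apply/seteqP; split=> d /=; rewrite in_itv /=.
    by case=> [[d1 d2 _]|/quot_lengthsP[d1 d2 _]]; apply/andP.
  move=> /andP[d1 d2].
  have [p0|p0] := pselect (p (obj k I y) (path y d) = 0); [left|right] => //.
  exact/quot_lengthsP.
move=> q u /quot_lengthsP[qxy _ pq] [uxy _ pu]; rewrite ltNge; apply/negP => uq.
exact/pq/(ker_path_up uxy uq pu).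
Qed.

End Kernel.

Theorem proposition4p4 (R : realType) (k : closedFieldType) (l r x : R)
    (hx : x \in `]l, r[)
    (M N : lmodule (LambdaI k `]l, r[%classic))
    (i : lmodmor M (Proj k `]l, r[%classic x))
    (p : lmodmor (Proj k `]l, r[%classic x) N) :
  short_exact i p -> (decorous_sub i <-> decorous_quot p).
Proof.
move=> ip.
by split=> dec y Iy; [apply/(decorous_at ip)/dec | apply/(decorous_at ip)/dec].
Qed.
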